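(* Let $B\subset W$ be a good lattice and $A$ a self-dual lattice with $B\subset A\subset B^*$. For every $g\in K_B$, $$\mathcal{I}_{A,B}\circ S^B_\psi(g)=m\bigl(p_{Sp(\mathrm{b}^* )}(g)\bigr)\,q^{\frac12 j(p_{Sp(\mathrm{b}^* )}(g))}\,M_A(g)\circ\mathcal{I}_{A,B}.$$
   Context: $k$ is a non-archimedean local field of characteristic $0$ with ring of integers $\mathcal{O}$, uniformizer $\varpi$, residue field $\mathbb{F}_q$ of characteristic $p\neq2$; $\psi$ is a non-trivial unitary character of $(k,+)$ with conductor $\lambda_\psi$ (trivial on $\varpi^{\lambda_\psi}\mathcal{O}$, not on $\varpi^{\lambda_\psi-1}\mathcal{O}$); $\overline\psi$ is the character of $\mathbb{F}_q$ with $\overline\psi(x\bmod\varpi)=\psi(\varpi^{\lambda_\psi-1}x)$. $(W,\beta)$ is a symplectic $k$-space of dimension $2r>0$. A lattice is a compact open $\mathcal{O}$-submodule; $B^*=\{v\in W:\beta(v,b)\in\varpi^{\lambda_\psi}\mathcal{O}\ \forall b\in B\}$; $B$ is good if $\varpi B^*\subset B\subset B^*$, self-dual if $B=B^*$. $K_B$ is the stabilizer of $B$ in $Sp(W)$. $\mathrm{b}^*=B^*/B$ is an $\mathbb{F}_q$-space with symplectic form $\beta_{\mathrm{b}^*}(\bar v,\bar w)=\varpi^{1-\lambda_\psi}\beta(v,w)\bmod\varpi$, of dimension $2l$; $p_{Sp(\mathrm{b}^* )}:K_B\to Sp(\mathrm{b}^* )$ is the induced morphism. $\mathrm{x}=A/B$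 is a Lagrangian of $\mathrm{b}^*$. **Finite field data.** For a symplectic space $V$ over $F$, $H(V)=V\times F$ with $(w,t)(w',t')=(w+w',t+t'+\frac12\beta(w,w'))$. $\mathcal{H}^{\mathrm{x}}_{\overline\psi}$ is the space of functions $\varphi:\mathrm{b}^*\to\mathbb{C}$ with $\varphi(a+w)=\overline\psi(\frac12\beta_{\mathrm b^*}(w,a))\varphi(w)$ for $a\in\mathrm{x}$, with $\rho_{\overline\psi}(w,t)\varphi(w')=\overline\psi(t+\frac12\beta_{\mathrm b^*}(w',w))\varphi(w'+w)$, $(w,t)\in H(\mathrm b^* )$. Put $j(g)=l-\dim(\mathrm{x}\cap g\mathrm{x})$ for $g\in Sp(\mathrm b^* )$, $\omega(a)=q^{-1/2}\sum_{t\in\mathbb{F}_q}\overline\psi(\frac12at^2)$ (depends only on $a$ mod squares), and let $\theta:Sp(\mathrm{b}^* )\to\mathbb{F}_q^\times/(\mathbb{F}_q^\times)^2$ be the function with $\theta(p_1gp_2)=\theta(p_1)\theta(g)\theta(p_2)$ for $p_1,p_2$ in the stabilizer $P$ of $\mathrm{x}$, $\theta(p)=\det(p_{|\mathrm{x}})$ for $p\in P$, and $\theta(\tau_S)=1$ for $S\subset\{1,\dots,l\}$, where, for a symplectic basis $(e_i,f_i)$ of $\mathrm b^*$ with the $e_i$ spanning $\mathrm{x}$, $\tau_S e_i=f_i,\ \tau_Sf_i=-e_i$ for $i\in S$ and $\tau_S$ fixes $e_i,f_i$ for $i\notin S$. Put $m(g)=\omega(\theta(g))^{-1}\omega(1)^{1-j(g)}$.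 The canonical Weil representation of $Sp(\mathrm b^* )$ on $\mathcal{H}^{\mathrm{x}}_{\overline\psi}$ is $$S_{\overline\psi}(g)\varphi(w)=m(g)q^{j(g)/2}\,q^{-l}\sum_{x\in\mathrm{x}}\overline\psi(\tfrac12\beta_{\mathrm b^*}(x,w))\varphi(g^{-1}(w+x)).$$ **Generalized lattice model.** $\widetilde\rho_{\overline\psi}(b)=\rho_{\overline\psi}(b+B,0)$ for $b\in B^*$, $\widetilde S_{\overline\psi}=S_{\overline\psi}\circ p_{Sp(\mathrm{b}^* )}$. $\mathcal{H}^B_\psi$ is the Hilbert space of functions $\varphi:W\to\mathcal{H}^{\mathrm x}_{\overline\psi}$ with $\varphi(b+w)=\psi(\frac12\beta(w,b))\widetilde\rho_{\overline\psi}(b)\varphi(w)$ ($b\in B^*$, $w\in W$) and $\int_{W/B^*}\|\varphi\|^2<\infty$. For $g\in K_B$, $S^B_\psi(g)\varphi(w)=\widetilde S_{\overline\psi}(g)[\varphi(g^{-1}w)]$. **Lattice model.** $\mathcal{H}^A_\psi$ is the Hilbert space of functions $\varphi:W\to\mathbb{C}$ with $\varphi(a+w)=\psi(\frac12\beta(w,a))\varphi(w)$ ($a\in A$) and $\int_{W/A}|\varphi|^2<\infty$. For $g\in Sp(W)$, $$M_A(g)\varphi(w)=[A:A\cap gA]^{-1}\sum_{a\in A/(A\cap gA)}\psi(\tfrac12\beta(a,w))\varphi(g^{-1}(a+w)),\qquad\varphi\in\mathcal{H}^A_\psi.$$ $\mathcal{I}_{A,B}:\mathcal{H}^B_\psi\to\mathcal{H}^A_\psi$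 is the operator $\mathcal{I}_{A,B}(\varphi)(w)=\varphi(w)(0)$ (it intertwines the Heisenberg group actions $(w,t)\varphi(w')=\psi(t+\frac12\beta(w',w))\varphi(w'+w)$). *)

(* Defs.v *)
From HB Require Import structures.
From mathcomp Require Import all_boot all_order all_algebra all_fingroup all_field.
From mathcomp Require Import complex finmap.
From mathcomp Require Import all_classical all_reals all_analysis.

Set Implicit Arguments.
Unset Strict Implicit.
Unset Printing Implicit Defensive.

Import Order.TTheory GRing.Theory Num.Theory.
Import numFieldNormedType.Exports.
Import VectorInternalTheory.

Local Open Scope classical_set_scope.
Local Open Scope ring_scope.

(* [val_ge v n x] is [n <= v x] with the convention [v 0 = +oo]. *)
Definition val_ge (K : fieldType) (v : K -> int) (n : int) (x : K) : bool :=
  (x == 0) || (n <= v x).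

(* A non-archimedean local field: a complete discretely valued field with
   finite residue field, together with a uniformizer [unif] and a model
   [residue] of the residue field.  The value of [valuation] at 0 and the
   values of the reduction map [red] outside of the ring of integers are
   irrelevant. *)
Record naLocalField := NALocalField {
  lf_field :> fieldType;
  valuation : lf_field -> int;
  unif : lf_field;
  residue : finFieldType;
  red : lf_field -> residue;
  valuationM : forall x y, x != 0 -> y != 0 ->
    valuation (x * y) = valuation x + valuation y;
  valuationD : forall n x y, val_ge valuation n x -> val_ge valuation n y ->
    val_ge valuation n (x + y);
  unif_neq0 : unif != 0;
  valuation_unif : valuation unif = 1;
  valuation_complete : forall u : nat -> lf_field,
    (forall n, exists N, forall i j, (N <= i)%N -> (N <= j)%N ->
      val_ge valuation n (u i - u j)) ->
    exists l, forall n, exists N, forall i, (N <= i)%N ->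
      val_ge valuation n (u i - l);
  red1 : red 1 = 1;
  redD : forall x y, val_ge valuation 0 x -> val_ge valuation 0 y ->
    red (x + y) = red x + red y;
  redM : forall x y, val_ge valuation 0 x -> val_ge valuation 0 y ->
    red (x * y) = red x * red y;
  red_surj : forall a, exists2 x, val_ge valuation 0 x & red x = a;
  red_ker : forall x, val_ge valuation 0 x ->
    (red x == 0) = val_ge valuation 1 x
}.
Arguments valuation {_}.
Arguments red {_}.

Section LocalField.
Variable K : naLocalField.
Implicit Types (x y : K) (n : int).

Definition integers : set K := [set x | val_ge valuation 0 x].

Definition frac_ideal n : set K := [set unif K ^ n * y | y in integers].

Definition res_lift (a : residue K) : K :=
  xget 0 [set x | integers x /\ red x = a].

Lemma res_liftP a : integers (res_lift a) /\ red (res_lift a) = a.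
Proof.
rewrite /res_lift; apply: (@xgetPex _ 0 [set x | integers x /\ red x = a]).
by have [x xO xa] := red_surj a; exists x.
Qed.

Lemma valuation1 : valuation (1 : K) = 0.
Proof.
have := @valuationM K 1 1 (oner_neq0 _) (oner_neq0 _).
by rewrite mulr1 => /eqP; rewrite -subr_eq subrr eq_sym => /eqP.
Qed.

Lemma val_geM m n x y :
  val_ge valuation m x -> val_ge valuation n y -> val_ge valuation (m + n) (x * y).
Proof.
rewrite /val_ge; have [->|x0] := eqVneq x 0; first by rewrite mul0r eqxx.
have [->|y0] := eqVneq y 0; first by rewrite mulr0 eqxx.
by move=> /= mx ny; rewrite (valuationM x0 y0) lerD ?orbT.
Qed.

Lemma valuationN1 : valuation (-1 : K) = 0.
Proof.
have N10 : (-1 : K) != 0 by rewrite oppr_eq0 oner_neq0.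
have := valuationM N10 N10; rewrite mulrNN mulr1 valuation1 -mulr2n => /esym/eqP.
by rewrite mulrn_eq0 => /eqP.
Qed.

Lemma val_geN n x : val_ge valuation n (- x) = val_ge valuation n x.
Proof.
have imp (z : K) : val_ge valuation n z -> val_ge valuation n (- z).
  move=> nz; have N1 : val_ge valuation 0 (-1 : K).
    by rewrite /val_ge valuationN1 lexx orbT.
  by have := val_geM N1 nz; rewrite add0r mulN1r.
by apply/idP/idP => /imp //; rewrite opprK.
Qed.

Lemma val_geB n x y :
  val_ge valuation n x -> val_ge valuation n y -> val_ge valuation n (x - y).
Proof. by move=> nx ny; apply: valuationD; rewrite ?val_geN. Qed.

Lemma val_ge_le m n x : m <= n -> val_ge valuation n x -> val_ge valuation m x.
Proof.
rewrite /val_ge => mn; case: eqP => //= _; exact: le_trans.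
Qed.

Lemma val_ge0 n : val_ge valuation n (0 : K).
Proof. by rewrite /val_ge eqxx. Qed.

Lemma valuationV x : x != 0 -> valuation x^-1 = - valuation x.
Proof.
move=> x0; apply/eqP; rewrite -addr_eq0 addrC -valuationM ?invr_neq0 //.
by rewrite mulfV // valuation1.
Qed.

Lemma valuation_unifX n : valuation (unif K ^ n) = n.
Proof.
have natcase m : valuation (unif K ^+ m) = m%:Z.
  elim: m => [|m IH]; first by rewrite expr0 valuation1.
  rewrite exprS valuationM ?expf_neq0 ?unif_neq0 // IH valuation_unif.
  by rewrite -intS.
case: n => m; first exact: natcase.
by rewrite NegzE -invr_expz valuationV ?expf_neq0 ?unif_neq0 // natcase.
Qed.

Lemma unifX_neq0 n : unif K ^ n != 0.
Proof. exact/expfz_neq0/unif_neq0. Qed.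

Lemma frac_idealE n : frac_ideal n = [set x | val_ge valuation n x].
Proof.
apply/seteqP; split=> [_ [y Oy <-]|x nx] /=.
  have nn : val_ge valuation n (unif K ^ n).
    by rewrite /val_ge valuation_unifX lexx orbT.
  by have := val_geM nn Oy; rewrite addr0.
exists (unif K ^ (- n) * x); last by rewrite mulrA -expfzDr ?unif_neq0 // subrr mul1r.
have nn : val_ge valuation (- n) (unif K ^ (- n)).
  by rewrite /val_ge valuation_unifX lexx orbT.
by have := val_geM nn nx; rewrite addNr.
Qed.

End LocalField.

(* [K] endowed with the topology of its valuation. *)
Definition val_top (K : naLocalField) : Type := K.

Section Topology.
Variable K : naLocalField.

HB.instance Definition _ := Choice.on (val_top K).
HB.instance Definition _ := isPointed.Build (val_top K) (0 : K).

Definition val_ball (x : K) (n : int) : set K :=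
  [set y | val_ge valuation n (y - x)].

Definition val_nbhs (x : val_top K) : set_system (val_top K) :=
  [set U | exists n, val_ball x n `<=` U].

HB.instance Definition _ := hasNbhs.Build (val_top K) val_nbhs.

Lemma val_nbhs_filter (x : val_top K) : ProperFilter (nbhs x).
Proof.
apply: Build_ProperFilter.
  by case=> n /(_ x); apply; rewrite /val_ball /= subrr val_ge0.
split.
- by exists 0.
- move=> P Q [m mP] [n nQ]; exists (Num.max m n) => y mny; split.
    by apply: mP; apply: val_ge_le mny; rewrite le_max lexx.
  by apply: nQ; apply: val_ge_le mny; rewrite le_max lexx orbT.
- by move=> P Q PQ [n nP]; exists n => y /nP /PQ.
Qed.

Lemma val_nbhs_singleton (x : val_top K) (A : set (val_top K)) : nbhs x A -> A x.
Proof. by case=> n; apply; rewrite /val_ball /= subrr val_ge0. Qed.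

Lemma val_nbhs_nbhs (x : val_top K) (A : set (val_top K)) :
  nbhs x A -> nbhs x (nbhs^~ A).
Proof.
case=> n nA; exists n => y xy; exists n => z yz; apply: nA.
rewrite /val_ball /= -(subrK (y : K) (z : K)) -addrA.
exact: valuationD.
Qed.

HB.instance Definition _ := Nbhs_isNbhsTopological.Build (val_top K)
  val_nbhs_filter val_nbhs_singleton val_nbhs_nbhs.

End Topology.

Section Lattices.
Variables (K : naLocalField) (W : vectType K).
Implicit Types (L M : set W) (v w : W).

(* The image of [L] under the coordinate isomorphism of [W] with row vectors,
   which carry the product topology. *)
Definition coords L : set 'rV[val_top K]_(dim W) :=
  [set v2r v | v in L].

Definition is_lattice L : Prop :=
  [/\ L 0, (forall v w, L v -> L w -> L (v + w)),
      (forall a v, integers a -> L v -> L (a *: v)),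
      open (coords L) & compact (coords L)].

Definition coset_in L v : set W := [set w | L (w - v)].

Definition cosets M L : set (set W) := [set coset_in L v | v in M].

Definition dual_lattice (beta : W -> W -> K) (lam : int) (B : set W) : set W :=
  [set v | forall b, B b -> frac_ideal lam (beta v b)].

Definition is_good (beta : W -> W -> K) (lam : int) (B : set W) : Prop :=
  [set unif K *: v | v in dual_lattice beta lam B] `<=` B /\
  B `<=` dual_lattice beta lam B.

Definition is_self_dual (beta : W -> W -> K) (lam : int) (A : set W) : Prop :=
  A = dual_lattice beta lam A.

Lemma lattice_opp L v : is_lattice L -> L v -> L (- v).
Proof.
case=> _ _ LZ _ _ Lv; rewrite -scaleN1r; apply: LZ => //.
by rewrite /integers /= /val_ge valuationN1 lexx orbT.
Qed.

Lemma lattice_sub L v w : is_lattice L -> L v -> L w -> L (v - w).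
Proof.
by move=> lL Lv Lw; have [_ LD _ _ _] := lL; apply/LD => //; apply: lattice_opp.
Qed.

Lemma lattice_box L : is_lattice L -> exists n : int, forall v,
  (forall i, val_ge valuation n (v2r v 0 i)) -> L v.
Proof.
case=> L0 _ _ Lop _.
have : nbhs (v2r (0 : W) : 'rV[val_top K]_(dim W)) (coords L).
  by apply: open_nbhs_nbhs; split => //; exists 0.
case=> P nP PL.
have /choice [f fP] : forall i, exists n, forall x : K,
    val_ge valuation n x -> P 0 i x.
  move=> i; have [n nPi] := nP 0 i; exists n => x nx; apply: nPi.
  by rewrite /val_ball /= linear0 mxE subr0.
exists (\sum_i `|f i|) => v hv.
have [|w Lw /v2r_inj <- //] := PL (v2r v).
move=> i j; rewrite ord1; apply: fP; apply: val_ge_le (hv j).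
rewrite (bigD1 j) //= (le_trans (ler_norm _)) // lerDl.
by apply: sumr_ge0.
Qed.

Lemma lattice_finite_quotient L : is_lattice L ->
  exists s : seq W, forall v, L v -> exists2 w, w \in s &
    L ((unif K)^-1 *: (v - w)).
Proof.
move=> lL; have [L0 LD LZ Lop Lc] := lL.
pose f (w : W) := coords [set v | L ((unif K)^-1 *: (v - w))].
have f_open w : L w -> open (f w).
  move=> Lw; have [n hn] := lattice_box lL.
  rewrite openE => _ [v vw <-].
  exists (fun i j => val_ball (v2r v i j) (n + 1)).
    by move=> i j; exists (n + 1).
  move=> M hM; exists (r2v M); last first.
    exact: r2vK.
  rewrite /= -[X in X - w](subrK v) -addrA scalerDr; apply: LD => //.
  apply: hn => i; rewrite linearZ linearB /= r2vK !mxE.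
  have unV : val_ge valuation (-1) (unif K)^-1.
    by rewrite /val_ge valuationV ?unif_neq0 // valuation_unif lexx orbT.
  have nE : -1 + (n + 1) = n by rewrite addrC addrK.
  by have := val_geM unV (hM 0 i); rewrite nE.
have := Lc; rewrite compact_cover => /(_ W L f f_open).
case=> [|D DL Dcov].
  move=> _ [v Lv <-]; exists v => //; exists v => //=.
  by rewrite subrr scaler0.
exists (enum_fset D) => v Lv.
have [w /= wD [v' v'w /v2r_inj vv']] := Dcov _ (imageP _ Lv).
by exists w => //; rewrite -vv'.
Qed.

End Lattices.

(* [beta] is taken bilinear, so that [B^*/B] below is a group. *)
Record good_lattice (K : naLocalField) (W : vectType K)
    (beta : {skew_symmetric W}) (lam : int) := GoodLattice {
  gl_set :> set W;
  gl_lattice : is_lattice gl_set;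
  gl_good : is_good beta lam gl_set
}.

(* The underlying set of [B^*/B]: the cosets of [B] in [B^*]. *)
Definition bstar (K : naLocalField) (W : vectType K)
    (beta : {skew_symmetric W}) (lam : int) (B : good_lattice beta lam) : Type :=
  {C : set W | C \in cosets (dual_lattice beta lam B) B}.

Section Bstar.
Variables (K : naLocalField) (W : vectType K) (beta : {skew_symmetric W}).
Variables (lam : int) (B : good_lattice beta lam).
Notation F := (residue K).
Notation Bs := (gl_set B).
Notation Bd := (dual_lattice beta lam B).
Implicit Types (v w : W) (C D E : bstar B) (a b : F).

HB.instance Definition _ := [isSub of bstar B for @sval _ _].
HB.instance Definition _ := [Choice of bstar B by <:].

Let BP := gl_lattice B.

Lemma good_sub v : Bs v -> Bd v.
Proof. by case: (gl_good B) => _; apply. Qed.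

Lemma unif_dual v : Bd v -> Bs (unif K *: v).
Proof. by case: (gl_good B) => h _ Bv; apply: h; exists v. Qed.

Lemma B_0 : Bs 0. Proof. by case: BP. Qed.
Lemma B_D v w : Bs v -> Bs w -> Bs (v + w). Proof. by case: BP => _ + *; apply. Qed.
Lemma B_Z x v : integers x -> Bs v -> Bs (x *: v).
Proof. by case: BP => _ _ + *; apply. Qed.
Lemma B_N v : Bs v -> Bs (- v). Proof. exact: lattice_opp. Qed.
Lemma B_B v w : Bs v -> Bs w -> Bs (v - w). Proof. exact: lattice_sub. Qed.

Lemma Bd_0 : Bd 0. Proof. exact/good_sub/B_0. Qed.
Lemma Bd_D v w : Bd v -> Bd w -> Bd (v + w).
Proof.
move=> hv hw u Bu; have := (hv u Bu, hw u Bu).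
by rewrite frac_idealE /= linearDl => -[]; exact: valuationD.
Qed.
Lemma Bd_Z x v : integers x -> Bd v -> Bd (x *: v).
Proof.
move=> xO hv u Bu; have := hv u Bu.
rewrite frac_idealE /= linearZl_LR /= => lv.
by have := val_geM xO lv; rewrite add0r.
Qed.
Lemma Bd_N v : Bd v -> Bd (- v).
Proof.
move=> hv; rewrite -scaleN1r; apply: Bd_Z => //.
by rewrite /integers /= /val_ge valuationN1 lexx orbT.
Qed.

Lemma coset_in_eq v w : (coset_in B v = coset_in B w) <-> Bs (v - w).
Proof.
split=> [e|Bvw].
  have : coset_in B v v by rewrite /coset_in /= subrr; exact: B_0.
  by rewrite e.
apply/seteqP; split=> u /= Bu.
  by rewrite /coset_in /= -(subrK v u) -addrA; apply: B_D.
by rewrite /coset_in /= -(subrK w u) -addrA; apply: B_D => //; rewrite -opprB; apply: B_N.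
Qed.

Lemma bcls_subproof v : Bd v -> coset_in B v \in cosets Bd B.
Proof. by move=> hv; rewrite inE; exists v. Qed.

(* The projection [B^* -> B^*/B], extended by 0 outside of [B^*]. *)
Definition bcls v : bstar B :=
  insubd (Sub (coset_in B 0) (bcls_subproof Bd_0) : bstar B) (coset_in B v).

Definition brep C : W := xget 0 (val C).

Lemma val_bcls v : Bd v -> val (bcls v) = coset_in B v.
Proof. by move=> hv; rewrite insubdK //; exact: bcls_subproof. Qed.

Lemma bcls_eq v w : Bd v -> Bd w -> bcls v = bcls w <-> Bs (v - w).
Proof.
move=> hv hw; rewrite -coset_in_eq -!val_bcls //.
by split=> [->//|/val_inj].
Qed.

Lemma brepP C : Bd (brep C) /\ bcls (brep C) = C.
Proof.
have := valP C; rewrite inE => -[v hv vC].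
have Cr : val C (brep C).
  by apply: xgetPex; exists v; rewrite -vC /coset_in /= subrr; exact: B_0.
move: (Cr); rewrite -{1}vC => Bvr.
have hr : Bd (brep C) by rewrite -(subrK v (brep C)); apply: Bd_D => //; apply: good_sub.
split=> //; apply: val_inj; rewrite val_bcls // -vC.
exact/coset_in_eq.
Qed.

Lemma brep_dual C : Bd (brep C). Proof. by case: (brepP C). Qed.
Lemma brepK : cancel brep bcls. Proof. by move=> C; case: (brepP C). Qed.

Lemma brep_bcls v : Bd v -> Bs (brep (bcls v) - v).
Proof. by move=> hv; apply/(bcls_eq (brep_dual _) hv); rewrite brepK. Qed.

Definition badd C D := bcls (brep C + brep D).
Definition bopp C := bcls (- brep C).
Definition bscale a C := bcls (res_lift a *: brep C).

Lemma badd_cls v w : Bd v -> Bd w -> badd (bcls v) (bcls w) = bcls (v + w).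
Proof.
move=> hv hw; apply/bcls_eq; try by apply: Bd_D => //; exact: brep_dual.
by rewrite opprD addrACA; apply: B_D; apply: brep_bcls.
Qed.

Lemma bopp_cls v : Bd v -> bopp (bcls v) = bcls (- v).
Proof.
move=> hv; apply/bcls_eq; try by apply: Bd_N => //; exact: brep_dual.
by rewrite -opprD; apply/B_N/brep_bcls.
Qed.

Lemma bscale_cls (x : K) v : integers x -> Bd v ->
  bscale (red x) (bcls v) = bcls (x *: v).
Proof.
move=> xO hv; have [yO yx] := res_liftP (red x).
apply/bcls_eq; try by apply: Bd_Z => //; exact: brep_dual.
rewrite -(subrK (res_lift (red x) *: v) (_ *: brep _)) -addrA -scalerBr -scalerBl.
apply: B_D; first by apply: B_Z => //; apply: brep_bcls.
set d := _ - x; have dO : integers d by apply: val_geB.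
have : red d == 0.
  have -> : red d = red (d + x) - red x by rewrite (redD dO xO) addrK.
  by rewrite subrK yx subrr.
rewrite red_ker // => d1.
have unV : val_ge valuation (-1) (unif K)^-1.
  by rewrite /val_ge valuationV ?unif_neq0 // valuation_unif lexx orbT.
have dV : integers ((unif K)^-1 * d) by have := val_geM unV d1; rewrite addNr.
rewrite -(mulVKf (unif_neq0 K) d) mulrC -scalerA; apply: B_Z => //.
exact: unif_dual.
Qed.

Lemma baddA : associative badd.
Proof.
move=> C D E; rewrite -(brepK C) -(brepK D) -(brepK E).
have [hC hD hE] := And3 (brep_dual C) (brep_dual D) (brep_dual E).
by rewrite !badd_cls ?addrA //; apply: Bd_D.
Qed.

Lemma baddC : commutative badd.
Proof. by move=> C D; rewrite /badd addrC. Qed.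

Lemma badd0 : left_id (bcls 0) badd.
Proof. by move=> C; rewrite -(brepK C) badd_cls ?add0r //; [exact: Bd_0|exact: brep_dual]. Qed.

Lemma baddN : left_inverse (bcls 0) bopp badd.
Proof.
move=> C; rewrite -(brepK C); have hC := brep_dual C.
by rewrite bopp_cls // badd_cls ?addNr //; apply: Bd_N.
Qed.

HB.instance Definition _ := GRing.isZmodule.Build (bstar B) baddA baddC badd0 baddN.

Lemma bclsD v w : Bd v -> Bd w -> bcls (v + w) = bcls v + bcls w.
Proof. by move=> hv hw; rewrite [RHS]badd_cls. Qed.

Lemma bscaleA a b C : bscale a (bscale b C) = bscale (a * b) C.
Proof.
have [x xO <-] := red_surj a; have [y yO <-] := red_surj b.
rewrite -(brepK C); have hC := brep_dual C.
have xyO : integers (x * y) by have := val_geM xO yO; rewrite addr0.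
have hyC : Bd (y *: brep C) by apply: Bd_Z.
by rewrite -redM // !bscale_cls ?scalerA.
Qed.

Lemma bscale1 : left_id 1 bscale.
Proof.
move=> C; rewrite -(brepK C) -(red1 K) bscale_cls ?scale1r //; last exact: brep_dual.
by rewrite /integers /= /val_ge valuation1 lexx orbT.
Qed.

Lemma bscaleDr : right_distributive bscale +%R.
Proof.
move=> a C D; have [x xO <-] := red_surj a.
rewrite -(brepK C) -(brepK D); have [hC hD] := (brep_dual C, brep_dual D).
have hCD : Bd (brep C + brep D) by apply: Bd_D.
have [hxC hxD] : Bd (x *: brep C) /\ Bd (x *: brep D) by split; apply: Bd_Z.
by rewrite -bclsD // !bscale_cls ?scalerDr ?bclsD.
Qed.

Lemma bscaleDl C : {morph bscale^~ C : a b / a + b}.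
Proof.
move=> a b /=; have [x xO <-] := red_surj a; have [y yO <-] := red_surj b.
rewrite -(brepK C); have hC := brep_dual C.
have xyO : integers (x + y) by apply: valuationD.
have [hxC hyC] : Bd (x *: brep C) /\ Bd (y *: brep C) by split; apply: Bd_Z.
by rewrite -redD // !bscale_cls ?scalerDl ?bclsD.
Qed.

HB.instance Definition _ := GRing.Zmodule_isLmodule.Build F (bstar B)
  bscaleA bscale1 bscaleDr bscaleDl.

Lemma bclsZ (x : K) v : integers x -> Bd v -> bcls (x *: v) = red x *: bcls v.
Proof. by move=> xO hv; rewrite [RHS]bscale_cls. Qed.

Lemma bstar_finite : exists s : seq (bstar B), forall C, C \in s.
Proof.
have [s sP] := lattice_finite_quotient BP.
exists [seq bcls ((unif K)^-1 *: w) | w <- [seq w <- s | `[< Bd ((unif K)^-1 *: w) >]]] => C.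
have [w ws] := sP _ (unif_dual (brep_dual C)).
rewrite scalerBr scalerA mulVf ?unif_neq0 // scale1r => Bw.
have hw : Bd ((unif K)^-1 *: w).
  rewrite -(subKr (brep C) (_ *: w)).
  by apply: Bd_D; [exact: brep_dual|apply/Bd_N/good_sub].
apply/mapP; exists w; first by rewrite mem_filter ws andbT; apply/asboolP.
by rewrite -[LHS]brepK; apply/bcls_eq => //; exact: brep_dual.
Qed.

Lemma bstar_findim : exists n, exists f : bstar B -> 'rV[F]_n, linear f /\ bijective f.
Proof.
have [s sP] := bstar_finite; pose N := size s.
pose r (c : 'rV[F]_N) : bstar B := \sum_i c 0 i *: s`_i.
have r_lin : linear r.
  move=> a c d; rewrite /r scaler_sumr -big_split /=; apply: eq_bigr => i _.
  by rewrite !mxE scalerDl scalerA.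
have rB c d : r (c - d) = r c - r d.
  by rewrite addrC -scaleN1r r_lin scaleN1r addrC.
have r_surj C : exists c, r c = C.
  have iN : (index C s < N)%N by rewrite index_mem.
  exists (delta_mx 0 (Ordinal iN)); rewrite /r (bigD1 (Ordinal iN)) //=.
  rewrite big1 ?addr0 => [|j /negbTE ji]; last by rewrite mxE eqxx ji scale0r.
  by rewrite mxE !eqxx scale1r nth_index.
have r0 : r 0 = 0 by rewrite -(subrr 0) rB subrr.
pose X := [seq c <- enum [set: 'rV[F]_N]%SET | r c == 0].
pose U := <<X>>%VS.
have memU c : (c \in U) = (r c == 0).
  apply/idP/idP => [cU|rc]; last first.
    by apply: memv_span; rewrite mem_filter rc mem_enum inE.
  rewrite (@coord_span _ _ _ (in_tuple X) c cU).
  elim/big_ind: _ => [|x y /eqP rx /eqP ry|i _]; first by rewrite r0.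
    by rewrite -[x]scale1r r_lin scale1r rx ry addr0.
  have : (in_tuple X)`_i \in X by rewrite mem_nth.
  by rewrite mem_filter => /andP[/eqP ri _]; rewrite -[_ *: _]addr0 r_lin ri r0 scaler0 addr0.
pose V := (U^C)%VS; pose T := subvs_of V.
pose h (t : T) := r (vsval t).
have h_inj : injective h.
  move=> t u /eqP; rewrite /h -subr_eq0 -rB -memU => tu; apply: val_inj => /=.
  apply/eqP; rewrite -subr_eq0 -memv0 -(capv_compl U) memv_cap tu /=.
  by rewrite -raddfB subvsP.
have h_surj C : exists t, h t = C.
  have [c <-] := r_surj C.
  have /memv_addP[u uU [t tV ->]] : c \in (U + U^C)%VS by rewrite addv_complf memvf.
  exists (vsproj V t); rewrite /h vsprojK // -[u]scale1r r_lin scale1r.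
  by move: uU; rewrite memU => /eqP ->; rewrite add0r.
have [k kP] := choice h_surj.
have kK : cancel h k by move=> t; apply: h_inj.
have k_lin : linear k.
  move=> a C D; apply: h_inj; rewrite kP /h linearP r_lin.
  by rewrite -/(h _) -/(h _) !kP.
exists (dim T), (v2r \o k); split.
  by move=> a C D; rewrite /= k_lin linearP.
by apply: bij_comp; [exists r2v; [exact: v2rK|exact: r2vK]|exists h].
Qed.

Definition bstar_dim : nat := projT1 (cid bstar_findim).

Lemma bstar_vector : Vector.axiom bstar_dim (bstar B).
Proof. by rewrite /bstar_dim; case: cid => n /= /cid[f [fl fb]]; exists f. Qed.

HB.instance Definition _ := Lmodule_hasFinDim.Build F (bstar B) bstar_vector.

End Bstar.

(* [bcls] and [bclsD], [bclsZ], [bcls_eq], [brepK] exhibit [bstar B] as the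
   quotient of [B^*] by [B]; the form and the action of [K_B] are computed on
   the representatives [brep C] of the classes [C]. *)
Section BstarSymplectic.
Variables (K : naLocalField) (W : vectType K) (beta : {skew_symmetric W}).
Variables (lam : int) (B : good_lattice beta lam).

Definition bform (C D : bstar B) : residue K :=
  red (unif K ^ (1 - lam) * beta (brep C) (brep D)).

Definition bproj (g : 'End(W)) : 'End(bstar B) :=
  linfun (fun C : bstar B => bcls B (g (brep C))).

(* [A/B] as a subspace of [B^*/B]; by [mem_bsub] the span adds nothing. *)
Definition bsub (A : set W) : {vspace bstar B} :=
  <<[seq C <- enum (finvect_type (bstar B)) | `[< [set bcls B v | v in A] C >]]>>%VS.

Lemma mem_bsub (A : set W) (C : bstar B) : is_lattice A ->
  A `<=` dual_lattice beta lam B ->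
  C \in bsub A <-> exists2 v, A v & bcls B v = C.
Proof.
move=> [A0 AD AZ _ _] AB; rewrite /bsub; set X := [seq _ <- _ | _].
have memX D : (D \in X) = `[< [set bcls B v | v in A] D >].
  rewrite mem_filter; apply: andb_idr => _.
  exact: (mem_enum (finvect_type (bstar B)) D).
split=> [CX|[v Av <-]]; last by apply: memv_span; rewrite memX; apply/asboolP; exists v.
rewrite (@coord_span _ _ _ (in_tuple X) C CX).
elim/big_ind: _ => [|_ _ [v Av <-] [w Aw <-]|i _]; first by exists 0.
  by exists (v + w); [exact: AD|apply: bclsD; apply: AB].
have : (in_tuple X)`_i \in X by rewrite mem_nth.
rewrite memX => /asboolP[v Av <-].
have [a aO <-] := red_surj (coord (in_tuple X) i C).
by exists (a *: v); [exact: AZ|apply: bclsZ => //; apply: AB].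
Qed.

End BstarSymplectic.

(* Isometries of a nondegenerate form are automatically invertible. *)
Definition sp_group (F : fieldType) (V : vectType F) (b : V -> V -> F) : set 'End(V) :=
  [set g | forall v w, b (g v) (g w) = b v w].

Section FiniteWeil.
Variables (R : realType) (F : finFieldType) (V : vectType F).
Variables (b : V -> V -> F) (chi : F -> R[i]) (x : {vspace V}).
Implicit Types (g p : 'End(V)) (phi : V -> R[i]).

Definition schrodinger : set (V -> R[i]) :=
  [set phi | forall a w, a \in x -> phi (a + w) = chi (2^-1 * b w a) * phi w].

(* [h = (w, t)] ranges over the Heisenberg group, with underlying set [V * F]. *)
Definition heis (h : V * F) phi : V -> R[i] :=
  fun w => chi (h.2 + 2^-1 * b w h.1) * phi (w + h.1).

(* [|phi|^2]; the normalization of the invariant norm is immaterial below. *)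
Definition sqnorm phi : R := \sum_(v : finvect_type V) ComplexField.Normc.normc (phi v) ^+ 2.

Definition half_dim : nat := (\dim {:V})./2.

Definition jdim g : nat := half_dim - \dim (x :&: (g @: x)).

Definition omega (a : F) : R[i] :=
  (sqrtC #|F|%:R)^-1 * \sum_(t : F) chi (2^-1 * a * t ^+ 2).

(* The squares are closed under product, so this is just the set of squares. *)
Definition unit_squares : {set {unit F}} := <<[set (u ^+ 2)%g | u : {unit F}]>>%g.

Definition square_class : predArgType := coset_of unit_squares.

Definition omega_class (c : square_class) : R[i] := omega (val (repr c)).

Definition sp_stab : set 'End(V) := [set p | sp_group b p /\ (p @: x)%VS = x].

Definition det_on p : F :=
  \det (\matrix_(i < \dim x, j < \dim x) coord (vbasis x) j (p (vbasis x)`_i)).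

Definition adapted_basis (e f : 'I_half_dim -> V) : Prop :=
  [/\ basis_of fullv ([seq e i | i : 'I_half_dim] ++ [seq f i | i : 'I_half_dim]),
      <<[seq e i | i : 'I_half_dim]>>%VS = x,
      (forall i j, b (e i) (e j) = 0), (forall i j, b (f i) (f j) = 0) &
      (forall i j, b (e i) (f j) = (i == j)%:R)].

Definition is_tau (e f : 'I_half_dim -> V) (S : {set 'I_half_dim}) (tau : 'End(V)) :=
  forall i, tau (e i) = (if i \in S then f i else e i) /\
            tau (f i) = (if i \in S then - e i else f i).

(* The values of [theta] outside of [sp_group b] are irrelevant. *)
Definition is_theta (theta : 'End(V) -> square_class) : Prop :=
  [/\ (forall p1 g p2, sp_stab p1 -> sp_group b g -> sp_stab p2 ->
        theta (p1 \o g \o p2)%VF = (theta p1 * theta g * theta p2)%g),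
      (forall p (u : {unit F}), sp_stab p -> val u = det_on p ->
        theta p = coset unit_squares u) &
      exists e f, adapted_basis e f /\
        forall S tau, is_tau e f S tau -> theta tau = 1%g].

Variable theta : 'End(V) -> square_class.

Definition weil_factor g : R[i] :=
  (omega_class (theta g))^-1 * omega 1 ^ (1 - (jdim g)%:Z).

Definition weil g phi : V -> R[i] := fun w =>
  weil_factor g * sqrtC #|F|%:R ^+ jdim g * #|F|%:R ^- half_dim *
  \sum_(v : finvect_type V | v \in x)
    chi (2^-1 * b v w) * phi ((g^-1)%VF (w + v)).

End FiniteWeil.

Section Models.
Variables (R : realType) (K : naLocalField) (psi : K -> R[i]).

Definition is_unitary_character : Prop :=
  [/\ forall x y, psi (x + y) = psi x * psi y,
      forall x, `|psi x| = 1,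
      continuous (psi : val_top K -> (R[i] : numFieldType)) &
      exists x, psi x != 1].

Definition is_conductor (lam : int) : Prop :=
  (forall x, frac_ideal lam x -> psi x = 1) /\
  exists2 x, frac_ideal (lam - 1) x & psi x != 1.

Definition psibar (lam : int) (a : residue K) : R[i] :=
  psi (unif K ^ (lam - 1) * res_lift a).

Variables (W : vectType K) (beta : {skew_symmetric W}) (lam : int).
Variables (B : good_lattice beta lam) (A : set W).
Implicit Type g : 'End(W).

Definition lattice_stab : set 'End(W) :=
  [set g | sp_group beta g /\ g @` B = B].

Definition rho_tilde (b : W) : (bstar B -> R[i]) -> bstar B -> R[i] :=
  heis (@bform _ _ _ _ B) (psibar lam) (bcls B b, 0).

(* [W/B^*] is discrete, so that the integral over [W/B^*] is the sum over the
   cosets of [B^*], up to the normalization of the measure. *)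
Definition gen_lattice_model : set (W -> bstar B -> R[i]) :=
  [set phi | [/\
    forall w, schrodinger (@bform _ _ _ _ B) (psibar lam) (bsub B A) (phi w),
    forall b w u, dual_lattice beta lam B b ->
      phi (b + w) u = psi (2^-1 * beta w b) * rho_tilde b (phi w) u &
    (\esum_(C in cosets setT (dual_lattice beta lam B))
       (sqnorm (phi (xget 0 C)))%:E < +oo)%E]].

Variable theta : 'End(bstar B) -> square_class (residue K).

Definition S_gen g (phi : W -> bstar B -> R[i]) : W -> bstar B -> R[i] :=
  fun w => weil (@bform _ _ _ _ B) (psibar lam) (bsub B A) theta (bproj B g)
             (phi ((g^-1)%VF w)).

Definition M_lattice g (phi : W -> R[i]) : W -> R[i] := fun w =>
  #|` fset_set (cosets A (A `&` g @` A))|%:R^-1 *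
  \sum_(C \in cosets A (A `&` g @` A))
    psi (2^-1 * beta (xget 0 C) w) * phi ((g^-1)%VF (xget 0 C + w)).

Definition intertwiner (phi : W -> bstar B -> R[i]) : W -> R[i] :=
  fun w => phi w 0.

End Models.

(* Main.v *)
Require Import Defs.
From HB Require Import structures.
From mathcomp Require Import all_boot all_order all_algebra all_fingroup all_field.
From mathcomp Require Import complex finmap.
From mathcomp Require Import all_classical all_reals all_analysis.

Set Implicit Arguments.
Unset Strict Implicit.
Unset Printing Implicit Defensive.

Import Order.TTheory GRing.Theory Num.Theory.

Local Open Scope classical_set_scope.
Local Open Scope ring_scope.

(** Both sides are averages of the same function.  Write [f] for the value of
    [phi] at [g^-1 w].  The equivariance of [phi] under [B^*] turns the term of
    [M_A(g)] at [a] into [f] evaluated at the class of [g^-1 a], the two [psi]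
    factors cancelling by skew-symmetry.  At [0] the Weil operator gives the
    average of [f (g^-1 v)] over [v] in [A/B], because [|A/B| = q^l].  As
    [A/B] is isotropic and [f] is in the Schroedinger model, [f (g^-1 v)] only
    depends on [v] modulo the image of [A `&` g A], and all the fibres of
    [A/B -> A/(A `&` g A)] have the same size. *)

(** Regrouping the sum along the fibres of [P], each of size [n], multiplies by [n] the sum over
    [D]; the constant function 1 gives the same factor for the cardinals. As [n] is positive, it
    cancels in the quotient. *)
Lemma mean_fibration (C : numFieldType) (T : finType) (U : choiceType)
    (X : {pred T}) (P : T -> U) (D : {fset U}) (h : T -> C) (k : U -> C) (n : nat) :
  (0 < n)%N ->
  {in X, forall v, P v \in D} -> {in X, forall v, h v = k (P v)} ->
  {in D, forall c, #|[pred v | (v \in X) && (P v == c)]| = n} ->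
  #|X|%:R^-1 * \sum_(v in X) h v = #|` D|%:R^-1 * \sum_(c <- D) k c.
Proof.
move=> n0 PD hk Pn.
have split (f : U -> C) : \sum_(v in X) f (P v) = n%:R * \sum_(c <- D) f c.
  rewrite big_distrr /=.
  transitivity (\sum_(v in X) \sum_(c <- D | P v == c) f c).
    apply: eq_bigr => v Xv.
    rewrite -big_filter (eq_filter (a2 := pred1 (P v))) => [|c]; last exact: eq_sym.
    by rewrite (filter_pred1_uniq (fset_uniq D) (PD v Xv)) big_seq1.
  rewrite (exchange_big_dep predT) //= big_seq [RHS]big_seq.
  by apply: eq_bigr => c Dc; rewrite sumr_const Pn // mulr_natl.
have cardX : #|X|%:R = n%:R * #|` D|%:R :> C.
  by have := split (fun=> 1); rewrite sumr_const big_const_seq count_predT iter_addr_0.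
rewrite (eq_bigr (k \o P) hk) split cardX invfM mulrACA.
by rewrite mulVf ?mul1r // pnatr_eq0 -lt0n.
Qed.

Section Reduction.
Variables (K : naLocalField) (W : vectType K) (beta : {skew_symmetric W}).
Variables (lam : int) (B : good_lattice beta lam).
Local Notation Bd := (dual_lattice beta lam B).

Lemma skewC (v w : W) : beta v w = - beta w v.
Proof. by rewrite hermC /= expr1 mulN1r. Qed.

Lemma bcls0 : bcls B 0 = 0. Proof. by []. Qed.

(** [bform] is computed on chosen representatives. Passing to them changes [beta] by pairings of
    [B^*] with [B], which stay in the ideal of level [lam]; scaling by [unif ^ (1 - lam)] then gives
    valuation at least 1, which [red] kills. *)
Lemma bform_eq0 (v w : W) : Bd v -> Bd w -> frac_ideal lam (beta v w) ->
  bform (bcls B v) (bcls B w) = 0.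
Proof.
move=> hv hw; rewrite frac_idealE /= => vw.
have lamP z : frac_ideal lam z -> val_ge valuation lam z by rewrite frac_idealE.
set v' := brep (bcls B v); set w' := brep (bcls B w).
have v'v : gl_set B (v' - v) by apply: brep_bcls.
have w'w : gl_set B (w' - w) by apply: brep_bcls.
have hv' : Bd v' by apply: brep_dual.
have vw' : val_ge valuation lam (beta v' w').
  have -> : beta v' w' = beta v' (w' - w) - beta w (v' - v) + beta v w.
    by rewrite !linearBr /= (skewC w v) (skewC w v') opprB opprK (addrC (- beta v w)) addrA !subrK.
  apply: valuationD vw; apply: val_geB; apply: lamP; [exact: hv'|exact: hw].
have ge1 : val_ge valuation 1 (unif K ^ (1 - lam) * beta v' w').
  have := @val_geM K (1 - lam) lam (unif K ^ (1 - lam)) _ _ vw'.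
  by rewrite subrK; apply; rewrite /val_ge valuation_unifX lexx orbT.
by apply/eqP; rewrite /bform red_ker //; exact: val_ge_le ge1.
Qed.

Lemma bform0r (C : bstar B) : bform C 0 = 0.
Proof.
rewrite -(brepK C) -bcls0; apply: bform_eq0; [exact: brep_dual|exact: Bd_0|].
by rewrite linear0r frac_idealE /=; exact: val_ge0.
Qed.

Lemma bform0l (C : bstar B) : bform 0 C = 0.
Proof.
rewrite -(brepK C) -bcls0; apply: bform_eq0; [exact: Bd_0|exact: brep_dual|].
by rewrite linear0l frac_idealE /=; exact: val_ge0.
Qed.

Lemma brepD_cls (C : bstar B) (a : W) : Bd a ->
  gl_set B (brep (C + bcls B a) - (brep C + a)).
Proof.
move=> ha; have hC := brep_dual C.
by rewrite -{1}(brepK C) -bclsD //; apply: brep_bcls; exact: Bd_D.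
Qed.

(** A vector killed by an isometry is orthogonal to all of [W], so nondegeneracy makes it 0. This is
    what turns [g^-1] into a genuine inverse. *)
Lemma sp_group_lker0 (g : 'End(W)) : is_psymplectic beta -> sp_group beta g ->
  lker g == 0%VS.
Proof.
move=> [ndg _ _] gsp; rewrite -subv0 -(eqP ndg); apply/subvP => v /[!memv_ker] /eqP gv0.
apply/mem_orthovP => w _.
by rewrite /= -gsp gv0 linear0l.
Qed.

Section Stabilizer.
Variable g : 'End(W).
Hypotheses (gB : lattice_stab B g) (g_inj : lker g == 0%VS).

Lemma lattice_stabP v : gl_set B (g v) <-> gl_set B v.
Proof.
case: gB => _ gBB; split=> [|Bv]; last by rewrite -gBB; exists v.
by rewrite -{1}gBB => -[u Bu /(lker0P g_inj) <-].
Qed.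

Lemma dual_stabP v : Bd (g v) <-> Bd v.
Proof.
case: gB => gsp gBB; split=> hv b Bb.
  by rewrite -gsp; apply: hv; apply/lattice_stabP.
by move: Bb; rewrite -{1}gBB => -[u Bu <-]; rewrite gsp; apply: hv.
Qed.

Lemma dual_stabV v : Bd v -> Bd ((g^-1)%VF v).
Proof. by move=> hv; apply/dual_stabP; rewrite lker0_lfunVK. Qed.

(** [linfun] returns the given function only when that function is linear. Linearity of [f] is
    checked by lifting scalars and classes to [K] and [W], once [f] is known not to depend on
    representatives because [g] preserves [B]. *)
Lemma bproj_cls v : Bd v -> bproj B g (bcls B v) = bcls B (g v).
Proof.
move=> hv; pose f (C : bstar B) := bcls B (g (brep C)).
have fE u : Bd u -> f (bcls B u) = bcls B (g u).
  move=> hu; apply/bcls_eq; [exact/dual_stabP/brep_dual|exact/dual_stabP|].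
  by rewrite -linearB; apply/lattice_stabP/brep_bcls.
have f_lin : linear f.
  move=> a C D; have [x xO <-] := red_surj a.
  rewrite -(brepK C) -(brepK D); have [hC hD] := (brep_dual C, brep_dual D).
  have hxC : Bd (x *: brep C) by apply: Bd_Z.
  rewrite -bclsZ // -bclsD // !fE //; last exact: Bd_D.
  rewrite linearP bclsD; [|apply: Bd_Z => //|]; try exact/dual_stabP.
  by rewrite bclsZ //; apply/dual_stabP.
pose fl := GRing.isLinear.Build _ _ _ _ f f_lin.
pose fL : {linear bstar B -> bstar B} := HB.pack f fl.
by rewrite /bproj -/f -[f]/(fL : _ -> _) lfunE; exact: fE.
Qed.

Lemma bprojV_cls v : Bd v -> ((bproj B g)^-1)%VF (bcls B v) = bcls B ((g^-1)%VF v).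
Proof.
move=> hv.
have bg_inj : lker (bproj B g) == 0%VS.
  apply/lker0P => C D; rewrite -(brepK C) -(brepK D).
  have [hC hD] := (brep_dual C, brep_dual D).
  rewrite !bproj_cls // => /bcls_eq e; apply/bcls_eq => //.
  by apply/lattice_stabP; rewrite linearB; apply: e; apply/dual_stabP.
apply: (lker0P bg_inj); rewrite lker0_lfunVK // bproj_cls ?lker0_lfunVK //.
exact: dual_stabV.
Qed.

End Stabilizer.
End Reduction.

Section Characters.
Variables (R : realType) (K : naLocalField) (psi : K -> R[i]).

Lemma unitary_character0 : is_unitary_character psi -> psi 0 = 1.
Proof.
case=> psiD psi1 _ _; have psi0 : psi 0 != 0 by rewrite -normr_gt0 psi1.
by apply: (mulIf psi0); rewrite -psiD addr0 mul1r.
Qed.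

(** The lift of 0 chosen by [res_lift] need not be 0, but it has valuation at least 1, and the
    factor [unif ^ (lam - 1)] brings it into the ideal where [psi] is trivial. *)
Lemma psibar0 lam : is_conductor psi lam -> psibar psi lam 0 = 1.
Proof.
case=> + _; apply; rewrite frac_idealE /=.
have [z0 /eqP] := res_liftP (0 : residue K); rewrite red_ker // => ge1.
have := @val_geM K (lam - 1) 1 (unif K ^ (lam - 1)) _ _ ge1.
by rewrite subrK; apply; rewrite /val_ge valuation_unifX lexx orbT.
Qed.

End Characters.

(** This gives the dimension of [A/B], hence its cardinal: the [e i] are free as part of a basis,
    and they span [x]. *)
Lemma adapted_basis_dim (F : finFieldType) (V : vectType F) (b : V -> V -> F)
    (x : {vspace V}) (e f : 'I_(half_dim V) -> V) :
  adapted_basis b x e f -> \dim x = half_dim V.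
Proof.
case=> /andP[_ fr] <- _ _ _; apply: eq_trans (_ : size [seq e i | i : 'I_(half_dim V)] = _).
  exact/eqP/(catl_free fr).
by rewrite size_map size_enum_ord.
Qed.

Theorem mainTheorem3 (R : realType) (K : naLocalField)
  (charK : [pchar K] =i pred0) (charF : 2%N \notin [pchar (residue K)])
  (psi : K -> R[i]) (lam : int)
  (psi_char : is_unitary_character psi) (psi_cond : is_conductor psi lam)
  (W : vectType K) (r : nat) (r_gt0 : (0 < r)%N) (dimW : \dim {:W} = (2 * r)%N)
  (beta : {skew_symmetric W}) (beta_symp : is_psymplectic beta)
  (B : good_lattice beta lam)
  (A : set W) (A_lattice : is_lattice A) (A_dual : is_self_dual beta lam A)
  (BA : gl_set B `<=` A) (AB : A `<=` dual_lattice beta lam B)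
  (theta : 'End(bstar B) -> square_class (residue K))
  (theta_spec : is_theta (@bform _ _ _ _ B) (bsub B A) theta)
  (g : 'End(W)) (gB : lattice_stab B g)
  (phi : W -> bstar B -> R[i]) (phiB : gen_lattice_model psi A phi) (w : W) :
  intertwiner (S_gen psi A theta g phi) w =
    weil_factor (psibar psi lam) (bsub B A) theta (bproj B g)
    * sqrtC #|residue K|%:R ^+ jdim (bsub B A) (bproj B g)
    * M_lattice psi beta A g (intertwiner phi) w.
Proof.
rewrite /intertwiner /S_gen /weil /M_lattice -[LHS]mulrA; congr (_ * _).
have [gsp gBB] := gB; have g_inj := sp_group_lker0 beta_symp gsp.
have gVK := lker0_lfunVK g_inj; have gK := lker0_lfunK g_inj.
have [phix phiBd _] := phiB; have [_ _ [e [f [ef _]]]] := theta_spec.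
set N := A `&` g @` A; set f0 := phi ((g^-1)%VF w).
have [A0 AD _ _ _] := A_lattice.
have AN v : A v -> A (- v) by apply: lattice_opp.
have mem_x v : v \in bsub B A <-> A (brep v).
  rewrite mem_bsub //; split=> [[a Aa <-]|Av]; last by exists (brep v); rewrite ?brepK.
  rewrite -(subrK a (brep _)); apply: AD => //; apply: BA; apply: brep_bcls.
  exact: AB.
have N_D u v : N u -> N v -> N (u + v).
  move=> [Au [u' Au' gu]] [Av [v' Av' gv]]; split; first exact: AD.
  by exists (u' + v'); [exact: AD|rewrite linearD /= gu gv].
have N_N u : N u -> N (- u).
  move=> [Au [u' Au' gu]]; split; first exact: AN.
  by exists (- u'); [exact: AN|rewrite linearN /= gu].
(* Since [B] lies in [N], the choices of representatives made by [brep] do not affect cosets of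
   [N]. *)
have BN b : gl_set B b -> N b.
  move=> Bb; split; first exact: BA.
  by move: Bb; rewrite -{1}gBB => -[u Bu <-]; exists u => //; exact: BA.
have coset_eq u v : coset_in N u = coset_in N v <-> N (u - v).
  split=> [uv|Nuv].
    have : coset_in N u u by rewrite /coset_in /= subrr; exact/BN/B_0.
    by rewrite uv.
  apply/seteqP; split=> z /= Nz; rewrite /coset_in /=.
    by rewrite -(subrK u z) -addrA; apply: N_D.
  by rewrite -(subrK v z) -addrA; apply: N_D => //; rewrite -opprB; exact: N_N.
pose T := finvect_type (bstar B); pose P (v : T) := coset_in N (brep (v : bstar B)).
have DE : cosets A N = P @` [set v : T | (v : bstar B) \in bsub B A].
  apply/seteqP; split=> [_ [a Aa <-]|_ [v xv <-]].
    exists (bcls B a); first by apply/mem_bsub => //; exists a.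
    by apply/coset_eq/BN/brep_bcls/AB.
  by exists (brep (v : bstar B)) => //; exact/mem_x.
have D_fin : finite_set (cosets A N) by rewrite DE; exact/finite_image/finite_finset.
(* Rewrites the normalization of the Weil operator as the inverse of the number of classes in
   [A/B]. *)
have cardx : (#|residue K| ^ half_dim (bstar B))%N = #|[pred v : T | (v : bstar B) \in bsub B A]|.
  by rewrite -(adapted_basis_dim ef) -(card_vspace (bsub B A : {vspace T})).
rewrite fsbig_finite // -natrX cardx.
have term v : v \in bsub B A -> psibar psi lam (2^-1 * bform v 0) *
    f0 (((bproj B g)^-1)%VF (0 + v)) = f0 (bcls B ((g^-1)%VF (brep v))).
  move=> xv; rewrite bform0r mulr0 (psibar0 psi_cond) mul1r add0r.
  by rewrite -{1}(brepK v) (bprojV_cls gB g_inj) //; exact: brep_dual.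
rewrite (eq_bigr _ term).
pose k (C : set W) := psi (2^-1 * beta (xget 0 C) w) * phi ((g^-1)%VF (xget 0 C + w)) 0.
(* The common fibre size: the order of the image of [N] in [B^*/B]. *)
pose n := #|[pred v : T | ((v : bstar B) \in bsub B A) && `[< N (brep (v : bstar B)) >]]|.
apply: (mean_fibration (P := P) (k := k) (n := n)).
(* The representative of the zero class need not be 0, but it lies in [B]. *)
- apply/card_gt0P; exists 0; rewrite inE mem0v; apply/asboolP/BN.
  by have := brep_bcls (@Bd_0 _ _ _ _ B); rewrite subr0.
- by move=> v xv; rewrite in_fset_set // inE; exists (brep (v : bstar B)) => //; exact/mem_x.
- move=> v xv; have Av : A (brep (v : bstar B)) by exact/mem_x.
  (* [M_A(g)] uses its own representative [a] of the coset, related to [brep v] only modulo [N]. *)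
  set a := xget 0 (P v); have Na : N (a - brep (v : bstar B)).
    apply: (@xgetPex _ 0 (P v)); exists (brep (v : bstar B)).
    by rewrite /P /coset_in /= subrr; exact/BN/B_0.
  have Aa : A a by rewrite -(subrK (brep (v : bstar B)) a); apply: AD => //; case: Na.
  rewrite /k -/a linearD phiBd; last exact/(dual_stabV gB g_inj)/AB.
  rewrite /rho_tilde /heis /= bform0l mulr0 addr0 (psibar0 psi_cond) mul1r add0r -/f0.
  have [psiD _ _ _] := psi_char.
  rewrite -(gsp ((g^-1)%VF w)) !gVK mulrA -psiD -mulrDr (skewC beta a w) addNr mulr0.
  rewrite (unitary_character0 psi_char) mul1r.
  (* With [a - brep v = g d], the classes of [g^-1 a] and [g^-1 (brep v)] differ by that of [d], an
     element of [A/B], so the Schroedinger condition applies. *)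
  have [_ [d Ad gd]] := Na.
  have -> : a = g d + brep (v : bstar B) by rewrite gd subrK.
  rewrite linearD /= gK.
  have hv := dual_stabV gB g_inj (AB _ Av).
  rewrite bclsD //; last exact: AB.
  rewrite /f0 phix; last by apply/mem_bsub => //; exists d.
  (* The resulting character is trivial: [beta (g^-1 (brep v)) d = beta (brep v) (g d)] pairs two
     elements of the self-dual lattice [A]. *)
  rewrite bform_eq0 ?mulr0 ?(psibar0 psi_cond) ?mul1r //; first exact: AB.
  by rewrite -gsp gVK gd; move: Av; rewrite {1}A_dual; apply; case: Na.
- move=> c; rewrite in_fset_set // inE => -[a Aa <-].
  have hu : bcls B a \in bsub B A by apply/mem_bsub => //; exists a.
  (* Translation by the class of [a] carries the classes with representative in [N] onto the fibre
     over the coset of [a]; [brep] is additive only modulo [B], which [N] absorbs. *)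
  rewrite /n -!sum1_card (reindex_inj (addIr (bcls B a : T))).
  apply: eq_bigl => v; rewrite !inE rpredDr //; congr (_ && _).
  have Nva : N (brep (v + bcls B a) - a - brep v).
    by rewrite -addrA -opprD [a + _]addrC; apply: BN; exact/brepD_cls/AB.
  apply/eqP/asboolP => [/coset_eq Nv|Nv].
    by have := N_D _ _ Nv (N_N _ Nva); rewrite subKr.
  by apply/coset_eq; have := N_D _ _ Nva Nv; rewrite subrK.
Qed.
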